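(* There are absolute constants $0<a\le b$ such that for every fixed integer $k\ge 2$ and every sufficiently large $N$ (depending on $k$) there is an integer $c$ with $a\,\frac{\log N}{k}\le c\le b\,\frac{\log N}{k}$ (i.e. $c=\Theta(\log N/k)$) and an algorithm which colors online with $c$ colors any ordered family of $N$ intervals in $\mathbb{R}$ such that, throughout the process, for every point $x\in\mathbb{R}$ contained in at least $k$ of the intervals there exist two intervals of different colors containing $x$.
   Context: An interval is a set $\{x\in\mathbb{R} : x_0<x<x_1\}$ for fixed $x_0,x_1$. To color online with $c$ colors means: the intervals $I_1,\dots,I_N$ arrive one at a time, and on its arrival $I_i$ is irrevocably assigned one of $c$ available colors by a (deterministic) rule that knows only $I_1,\dots,I_i$ and the colors of $I_1,\dots,I_{i-1}$, and nothing about future intervals. The algorithm may depend on $N$ and $k$. ''Throughout the process'' means that the stated property holds for the family $\{I_1,\dots,I_i\}$ after $I_i$ is colored, for each $i$. *)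

(* Defs.v *)
From mathcomp Require Import all_boot all_order all_algebra.
From mathcomp Require Import all_classical all_reals all_analysis.
Set Implicit Arguments.
Unset Strict Implicit.
Unset Printing Implicit Defensive.
Import Order.TTheory GRing.Theory Num.Theory.
Local Open Scope classical_set_scope.
Local Open Scope ring_scope.

Definition open_interval (R : realType) (I : set R) : Prop :=
  exists x0 x1 : R, I = [set x | x0 < x < x1].

(* A history lists the intervals presented so far, in order of arrival, each
   with its color. *)
Definition history (R : realType) (c : nat) := seq (set R * 'I_c).

Definition online_rule (R : realType) (c : nat) :=
  history R c -> set R -> 'I_c.

Definition online_coloring (R : realType) (c : nat) (A : online_rule R c)
    (s : seq (set R)) : history R c :=
  foldl (fun h I => rcons h (I, A h I)) [::] s.

(* Intervals are counted with multiplicity: a family may repeat a set. *)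
Definition k_fold_two_colored (R : realType) (c k : nat) (h : history R c) :
    Prop :=
  forall x : R, (k <= count (fun p => x \in p.1) h)%N ->
    exists p q, [/\ p \in h, q \in h, p.1 x, q.1 x & p.2 != q.2].

Definition colors_online (R : realType) (c N k : nat) (A : online_rule R c) :
    Prop :=
  forall s : N.-tuple (set R), (forall j, open_interval (tnth s j)) ->
    forall i : nat, (i <= N)%N ->
      k_fold_two_colored k (online_coloring A (take i s)).

(* Main.v *)
Require Import Defs.
From mathcomp Require Import all_boot all_order all_algebra.
From mathcomp Require Import all_classical all_reals all_analysis.
From mathcomp Require Import zify lra.
Import Order.TTheory GRing.Theory Num.Theory.
Local Open Scope ring_scope.

(** A point matters only as long as all intervals covering it have the same
    color.  Reading the line from left to right and ignoring the points that are
    already two-colored, one sees uncovered stretches and stretches of one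
    color.  The proof maintains a subdivision of the line into finitely many
    consecutive blocks, each labelled by a color [i] and a bound [D] on the
    number of intervals over its points that are not yet two-colored, all of
    color [i] ([D = 0] for uncovered blocks).  Blocks may contain two-colored
    points, and this is what keeps them few.

    A new interval [(a, b)] of color [j] two-colors everything inside it that is
    covered and not purely of color [j].  What is left of one color inside is of
    color [j], so the blocks strictly between the block of [a] and the block of
    [b] merge into a single one, whose depth is one more than the largest depth
    that color [j] had there.  The two end blocks are merely trimmed, provided
    that [j] differs from both of their colors.  When [a] and [b] lie in the
    same covered block, that block needs no cut at all: the part inside becomes
    two-colored, hence invisible.

    A block of color [i] and depth [D > 0] has weight [2 ^ (lev i + m * D.-1)],
    where the [4 * m] colors are spread over [m] levels, four on each.  The key
    point ([light_color]) is that some [j] avoiding the two end colors makes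
    the new block weigh at most one more than the blocks it replaces: choose [j]
    with [lev j + m * depth j] minimal.  Then every admissible color is at least
    as deep as [j], and deeper if its level is lower; as at least two colors of
    each level are admissible, the replaced weights contain twice a geometric
    sum ending just below the new weight.

    Hence the total weight never exceeds the number of intervals
    ([light_subdivision_rcons]).  A point covered [k] times in one color would
    lie in a block of weight at least [2 ^ (m * k.-1)], which is impossible once
    [N < 2 ^ (m * k.-1)].  Taking the least multiple [m * k.-1] beyond
    [log_2 N] gives [4 * m] colors, which is of order [ln N / k]. *)

(** * Weights and the choice of a color *)

(** Raising the depth by one costs as much as climbing [m] levels, so for
    levels below [m] the weights of all pairs (level, positive depth) are the
    consecutive powers of two, ordered by depth first. *)
Definition weight (m b D : nat) : nat :=
  if D is D'.+1 then (2 ^ (b + m * D'))%N else 0%N.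

Lemma leq_weight (m b D D' : nat) :
  (D <= D')%N -> (weight m b D <= weight m b D')%N.
Proof.
case: D D' => [|D] [|D'] //= leD.
by rewrite leq_exp2l // leq_add2l leq_mul.
Qed.

Lemma sum_expn2 (u n : nat) :
  (u <= n)%N -> (\sum_(u <= b < n) 2 ^ b + 2 ^ u = 2 ^ n)%N.
Proof.
elim: n => [|n IHn]; first by rewrite leqn0 => /eqP->; rewrite big_geq.
rewrite leq_eqVlt => /orP[/eqP->|]; first by rewrite big_geq.
by rewrite ltnS => le_un; rewrite big_nat_recr //= addnAC IHn // expnS mul2n
  addnn.
Qed.

(** If the levels below [u] have depth [d.+1] and the others depth [d], the
    weights of the [m] levels are the [m] powers of two just below
    [weight m u d.+1], or all [u] powers below it when [d = 0].  In the latter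
    case there may be none; the added 1 pays for that. *)
Lemma weight_climb (m u d : nat) : (u < m)%N ->
  (weight m u d.+1 <=
   1 + 2 * \sum_(b < m) (if b < u then weight m b d.+1 else weight m b d))%N.
Proof.
move=> lt_um; have le_um := ltnW lt_um.
rewrite -(big_mkord xpredT
  (fun b => if b < u then weight m b d.+1 else weight m b d)%N).
rewrite (@big_cat_nat _ _ _ u) //=.
pose geom v w := (\sum_(v <= b < w) 2 ^ b)%N.
have -> : (\sum_(0 <= b < u) (if b < u then weight m b d.+1 else weight m b d)
           = geom 0 u * 2 ^ (m * d))%N.
  by rewrite big_distrl; apply: eq_big_nat => b /andP[_ ->] /=; rewrite expnD.
have -> : (\sum_(u <= b < m) (if b < u then weight m b d.+1 else weight m b d)
           = \sum_(u <= b < m) weight m b d)%N.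
  by apply: eq_big_nat => b /andP[le_ub _]; rewrite ltnNge le_ub.
rewrite /= expnD; have := sum_expn2 0 u (leq0n u).
rewrite -/(geom 0%N u) expn0; move: (geom 0%N u) => S HS.
case: d => [|d]; first by rewrite muln0 expn0; lia.
(* Up to the factor [2 ^ (m * d)] the sum now is
   [2 ^ m * (2 ^ u - 1) + (2 ^ m - 2 ^ u) = 2 ^ (m + u) - 2 ^ u]. *)
have -> : (\sum_(u <= b < m) weight m b d.+1 = geom u m * 2 ^ (m * d))%N.
  by rewrite big_distrl; apply: eq_bigr => b _; rewrite /= expnD.
have := sum_expn2 u m le_um; rewrite -/(geom u m); move: (geom u m) => T HT.
have H2 : (2 * 2 ^ u <= 2 ^ m)%N by rewrite -expnS leq_exp2l.
have H1 : (2 <= 2 ^ m)%N by rewrite -{1}(expn1 2) leq_exp2l //; lia.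
rewrite mulnS expnD.
move: (2 ^ (m * d))%N (2 ^ u)%N (2 ^ m)%N HS HT H1 H2 => A U M HS HT H1 H2.
suff : (U * M <= 2 * (S * M + T))%N by nia.
nia.
Qed.

(** Here [e1] and [e2] are the colors of the two end blocks.  Two forbidden
    colors leave at least two admissible ones among the four or more of each
    level, and this provides the factor 2 in [weight_climb]. *)
Lemma light_color {C : finType} (m : nat) (lev : C -> nat) (D : C -> nat)
    (e1 e2 : C) :
    (0 < m)%N -> (forall i, (lev i < m)%N) ->
    (forall b, (b < m)%N -> (4 <= #|[pred i | lev i == b]|)%N) ->
  exists j, [/\ j != e1, j != e2 &
    (weight m (lev j) (D j).+1 <=
     1 + \sum_(i | (i != e1) && (i != e2)) weight m (lev i) (D i))%N].
Proof.
move=> m_gt0 lev_lt lev4.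
pose P := [pred i | (i != e1) && (i != e2)].
have P2 b : (b < m)%N -> (2 <= #|[pred i | P i & lev i == b]|)%N.
  move=> /lev4 le4.
  have le_e : (#|[pred i | lev i == b & ~~ P i]| <= 2)%N.
    apply: leq_trans (subset_leq_card _) (_ : #|pred2 e1 e2| <= 2)%N.
      apply/fintype.subsetP => i; rewrite !inE negb_and !negbK.
      by case/andP.
    by rewrite card2; case: eqP.
  have split_b : (#|[pred i | lev i == b]| =
      #|[pred i | P i & lev i == b]| + #|[pred i | lev i == b & ~~ P i]|)%N.
    rewrite -(cardID P); congr addn; apply: eq_card => i; rewrite !inE //.
      by rewrite andbC.
    by rewrite andbC.
  by move: le4; rewrite split_b; lia.
have [j0 Pj0] : exists j0, P j0.
  have /card_gt0P[i] : (0 < #|[pred i | P i & lev i == 0%N]|)%N.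
    exact: leq_trans (P2 _ m_gt0).
  by rewrite !inE => /andP[Pi _]; exists i.
(* One interval more of color [i] yields the weight [2 ^ rank i].  As levels are
   below [m], minimality of [rank j] forces every admissible color to have
   depth at least [D j], and more on the levels below that of [j]. *)
pose rank i := (lev i + m * D i)%N.
case: (arg_minnP rank Pj0) => j /andP[j1 j2] minj.
exists j; split=> //.
apply: leq_trans (weight_climb _ _ _ (lev_lt j)) _.
rewrite leq_add2l (partition_big (fun i => Ordinal (lev_lt i)) xpredT) //=.
rewrite big_distrr; apply: leq_sum => b _.
set v := (if _ then _ else _).
apply: (@leq_trans (\sum_(i | P i && (lev i == b)) v)).
  by rewrite sum_nat_const leq_mul2r P2 ?orbT.
apply: leq_sum => i /andP[Pi /eqP levb]; have := minj i Pi.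
rewrite /rank levb /v; have := ltn_ord b.
case: ifP => [lt_b|nlt_b] lt_bm le_rank.
  by apply: (@leq_weight _ _ (D j).+1); have := lev_lt j; nia.
by apply: leq_weight; have := lev_lt j; nia.
Qed.

(** * Labels of points and blocks *)

Definition depth {C : eqType} (M : seq (C * nat)) (i : C) : nat :=
  (\max_(l <- M | l.1 == i) l.2)%N.

(** For each color, a deepest block of that color alone already has the weight
    counted on the left. *)
Lemma sum_weight_depth {C : finType} (m : nat) (lev : C -> nat) (P : pred C)
    (M : seq (C * nat)) :
  (\sum_(i | P i) weight m (lev i) (depth M i) <=
   \sum_(l <- M) weight m (lev l.1) l.2)%N.
Proof.
rewrite (partition_big fst xpredT) //= big_mkcond; apply: leq_sum => i _.
case: ifP => // _; rewrite /depth.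
elim: M => [|l M IHM]; first by rewrite !big_nil.
rewrite !big_cons; case: eqP => [->|_] //.
case: (leqP l.2 (\max_(p <- M | p.1 == i) p.2)%N) => _.
  exact: leq_trans IHM (leq_addl _ _).
exact: leq_addr.
Qed.

(** The label [l] is correct for a point whose covering intervals have the
    colors [cs].  Points that are already two-colored accept every label.  The
    last condition makes a positive depth certify that the point is covered, so
    that an interval of another color two-colors it. *)
Definition legit {C : eqType} (l : C * nat) (cs : seq C) : bool :=
  constant cs ==>
    [&& all (pred1 l.1) cs, (size cs <= l.2)%N
      & (0 < l.2)%N ==> (0 < size cs)%N].

Lemma constant_rcons (C : eqType) (cs : seq C) (j : C) :
  constant (rcons cs j) = all (pred1 j) cs.
Proof.
case: cs => [|i cs] //=; rewrite all_rcons /=.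
rewrite [j == i]eq_sym; by case: eqP => //= ->.
Qed.

Lemma legit_rcons_recolored {C : eqType} (l : C * nat) (cs : seq C) (j : C) :
  legit l cs -> (0 < l.2)%N -> l.1 != j -> ~~ constant (rcons cs j).
Proof.
rewrite /legit constant_rcons; case: cs => [|i cs] /=; first by case: l.2.
move=> + l2 lj; apply: contraL => /andP[/eqP ij csj].
by rewrite ij csj /= [j == _]eq_sym (negPf lj).
Qed.

(** An interval of color [j] turns the points of every block inside it into
    legitimate members of one block of color [j]: a point keeps a single color
    only if it was uncovered or purely of color [j].  Only the depths of the
    blocks of color [j] matter for the depth of the new block. *)
Lemma legit_rcons_merged {C : eqType} (l : C * nat) (D : nat) (cs : seq C)
    (j : C) :
  legit l cs -> (l.1 = j -> (l.2 <= D)%N) -> legit (j, D.+1) (rcons cs j).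
Proof.
rewrite /legit constant_rcons all_rcons size_rcons /= eqxx /= andbT ltnS.
move=> legl lj; apply/implyP=> csj; rewrite csj /=.
case: cs csj legl => [|i cs] //= /andP[/eqP-> ->] /= /and3P[/andP[/eqP jl _]].
by move=> le_cs _; apply: leq_trans le_cs (lj (esym jl)).
Qed.

Definition colors_at {R : realType} {c : nat} (h : history R c) (x : R) :
    seq 'I_c :=
  [seq p.2 | p <- h & x \in p.1].

Lemma colors_at_rcons (R : realType) (c : nat) (h : history R c) (I : set R)
    (j : 'I_c) (x : R) :
  colors_at (rcons h (I, j)) x =
    if x \in I then rcons (colors_at h x) j else colors_at h x.
Proof.
by rewrite /colors_at filter_rcons /=; case: ifP; rewrite ?map_rcons.
Qed.

Lemma colors_at_two (R : realType) (c : nat) (h : history R c) (x : R) :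
  ~~ constant (colors_at h x) ->
  exists p q, [/\ p \in h, q \in h, p.1 x, q.1 x & p.2 != q.2].
Proof.
case E: (colors_at h x) => [|i cs] //= /allPn[j csj ij].
have in_h k : k \in colors_at h x -> exists p, [/\ p \in h, p.1 x & p.2 = k].
  case/mapP => p; rewrite mem_filter => /andP[/set_mem px ph] ->.
  by exists p.
have [p [ph px pj]] : exists p, [/\ p \in h, p.1 x & p.2 = j].
  by apply: in_h; rewrite E inE csj orbT.
have [q [qh qx qi]] : exists p, [/\ p \in h, p.1 x & p.2 = i].
  by apply: in_h; rewrite E inE eqxx.
by exists p, q; rewrite pj qi.
Qed.

(** * The invariant *)

(** The blocks are given by the nondecreasing map [g] from points to block
    numbers and the list [L] of their labels.  This form avoids any bookkeeping
    of which block contains its end points.  Every [g x] is a valid index, so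
    the default label [l0] is immaterial. *)
Definition light_subdivision {R : realType} {c : nat} (m : nat)
    (lev : 'I_c -> nat) (h : history R c) : Prop :=
  exists (g : R -> nat) (L : seq ('I_c * nat)),
    [/\ {homo g : x y / x <= y >-> (x <= y)%N},
        forall x, (g x < size L)%N,
        forall l0 x, legit (nth l0 L (g x)) (colors_at h x) &
        (\sum_(l <- L) weight m (lev l.1) l.2 <= size h)%N].

(** The old blocks up to that of [a] and from that of [b] on are kept, and one
    block for [(a, b)] is inserted between them.  If both ends lie in the same
    block, cutting it would count its weight twice: this is harmless when its
    depth is 0, and otherwise no cut is made. *)
Lemma light_subdivision_rcons {R : realType} {c : nat} (m : nat)
    (lev : 'I_c -> nat) (h : history R c) (I : set R) :
    (0 < m)%N -> (forall i, (lev i < m)%N) ->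
    (forall b, (b < m)%N -> (4 <= #|[pred i | lev i == b]|)%N) ->
    open_interval I -> light_subdivision m lev h ->
  exists j, light_subdivision m lev (rcons h (I, j)).
Proof.
move=> m_gt0 lev_lt lev4 [a [b ->]] [g [L [g_homo g_lt legL sumL]]].
have l0 : 'I_c * nat by move: (g_lt 0); case: L {g_lt legL sumL} => [|l].
have inI x : (x \in [set x | a < x < b]%classic) = (a < x < b).
  by apply/idP/idP => [/set_mem|xI]; last exact/mem_set.
have [le_ba|lt_ab] := leP b a.
  exists l0.1, g, L; split=> // [l x|]; last by rewrite size_rcons leqW.
  rewrite colors_at_rcons inI ifN ?legL //.
  by apply/negP => /andP[ax /(lt_trans ax)]; rewrite ltNge le_ba.
pose s := g a; pose t := g b.
have le_st : (s <= t)%N by apply/g_homo/ltW.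
pose mid := take (t - s.+1) (drop s.+1 L).
have [j [js jt le_w]] :=
  light_color _ _ (depth mid) (nth l0 L s).1 (nth l0 L t).1 m_gt0 lev_lt lev4.
exists j.
have g_in x : a < x < b -> (s <= g x <= t)%N.
  by case/andP => ax xb; rewrite !g_homo // ltW.
have [/andP[/eqP st Ls_gt0]|open_st] :=
  boolP ((s == t) && (0 < (nth l0 L s).2))%N.
  exists g, L; split=> // [l x|]; last by rewrite size_rcons leqW.
  rewrite colors_at_rcons inI; case: ifP => [/g_in|_]; last exact: legL.
  rewrite -st -eqn_leq => /eqP gx; rewrite /legit implybE.
  rewrite (@legit_rcons_recolored _ (nth l0 L s)) //; first by rewrite gx legL.
  by rewrite eq_sym.
(* The kept blocks are those numbered at most [s] and at least [t]; the latter
   restart at [s.+2], after the new block [s.+1]. *)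
pose g' x := if x <= a then g x else if x < b then s.+1 else (g x - t + s.+2)%N.
have s_lt : (s < size L)%N by exact: g_lt.
have t_lt : (t < size L)%N by exact: g_lt.
have size_take_s : size (take s.+1 L) = s.+1 by rewrite size_takel.
exists g', (take s.+1 L ++ (j, (depth mid j).+1) :: drop t L); split.
- move=> x y le_xy; rewrite /g'.
  have := g_homo x y le_xy.
  have [xa|ax] := leP x a; have [ya|ay] := leP y a => //.
  + have := g_homo x a xa; rewrite -/s.
    by case: ifP => _; lia.
  + by have := lt_le_trans ax (le_trans le_xy ya); rewrite ltxx.
  + have [xb|bx] := ltP x b; have [yb|by_] := ltP y b; try by lia.
    by have := le_lt_trans bx (le_lt_trans le_xy yb); rewrite ltxx.
- move=> x; rewrite /g' size_cat /= size_take_s size_drop.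
  have := g_lt x; case: ifP => [xa|_].
    by have := g_homo x a xa; rewrite -/s; lia.
  by case: ifP => _; lia.
- move=> l x; rewrite colors_at_rcons inI /g' nth_cat size_take_s.
  have [xa|ax] := leP x a; rewrite /=.
    have le_s := g_homo x a xa; rewrite -/s in le_s.
    by rewrite ltnS le_s nth_take ?ltnS // legL.
  have [xb|bx] := ltP x b.
    rewrite ltnn subnn /=.
    have /andP[sx xt] : (s <= g x <= t)%N by rewrite g_in // ax.
    (* A block of color [j] meeting [(a, b)] is not an end block, so it is one
       of the merged blocks. *)
    apply: legit_rcons_merged (legL l0 x) _.
    move: sx; rewrite leq_eqVlt => /orP[/eqP <- E|sx].
      by rewrite E eqxx in js.
    move: xt; rewrite leq_eqVlt => /orP[/eqP -> E|xt E].
      by rewrite E eqxx in jt.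
    have mid_x : nth l0 L (g x) \in mid.
      have -> : nth l0 L (g x) = nth l0 mid (g x - s.+1).
        by rewrite nth_take ?nth_drop ?subnKC //; lia.
      apply: mem_nth; rewrite size_takel; first by lia.
      by rewrite size_drop leq_sub2r // ltnW.
    by rewrite /depth (big_rem _ mid_x) /= E eqxx leq_maxl.
  have t_le := g_homo b x bx; rewrite -/t in t_le.
  rewrite ifN; last by lia.
  have -> : (g x - t + s.+2 - s.+1 = (g x - t).+1)%N by lia.
  by rewrite /= nth_drop subnKC.
- rewrite size_rcons big_cat big_cons /=.
  have le_new : (2 ^ (lev j + m * depth mid j) <=
      1 + \sum_(l <- mid) weight m (lev l.1) l.2)%N.
    apply: leq_trans le_w _; rewrite leq_add2l; exact: sum_weight_depth.
  apply: leq_trans (_ : (_ <= (\sum_(l <- L) weight m (lev l.1) l.2).+1)%N) _;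
    last by rewrite ltnS.
  rewrite -{3}(cat_take_drop s.+1 L) big_cat /=.
  have [st|] := eqVneq s t; last first.
    move=> st; have {le_st st} lt_st : (s < t)%N by lia.
    rewrite -(cat_take_drop (t - s.+1) (drop s.+1 L)) big_cat /=.
    by rewrite drop_drop subnK // -/mid; lia.
  move: open_st; rewrite {1}st eqxx /= lt0n negbK => /eqP Ls0.
  rewrite -st (drop_nth l0 s_lt) big_cons Ls0 /=.
  by move: le_new; rewrite /mid -st (eqP (leqnSn s)) take0 big_nil; lia.
Qed.

Lemma light_subdivision_two_colored {R : realType} {c : nat} (m k : nat)
    (lev : 'I_c -> nat) (h : history R c) :
    (0 < k)%N -> (size h < 2 ^ (m * k.-1))%N ->
    light_subdivision m lev h ->
  k_fold_two_colored k h.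
Proof.
move=> k_gt0 lt_h [g [L [_ g_lt legL sumL]]] x le_k; apply: colors_at_two.
have l0 : 'I_c * nat by move: (g_lt 0); case: L {g_lt legL sumL} => [|l].
set l := nth l0 L (g x).
have lL : l \in L by exact: mem_nth.
apply/negP => cst; have := legL l0 x; rewrite /legit cst /= => /and3P[_ le_l _].
have {le_l} le_kl : (k <= l.2)%N.
  by apply: leq_trans le_k (leq_trans _ le_l); rewrite size_map size_filter.
have : (2 ^ (m * k.-1) <= weight m (lev l.1) l.2)%N.
  apply: leq_trans (leq_weight m _ _ _ le_kl).
  by case: k k_gt0 {lt_h le_k le_kl} => //= k _; rewrite leq_exp2l // leq_addl.
apply/negP; rewrite -ltnNge; apply: leq_ltn_trans lt_h; apply: leq_trans sumL.
by rewrite (big_rem _ lL) leq_addr.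
Qed.

(** * The online rule *)

Lemma online_coloring_rcons (R : realType) (c : nat) (A : online_rule R c)
    (s : seq (set R)) (I : set R) :
  online_coloring A (rcons s I) =
    rcons (online_coloring A s) (I, A (online_coloring A s) I).
Proof. by rewrite /online_coloring foldl_rcons. Qed.

Lemma size_online_coloring (R : realType) (c : nat) (A : online_rule R c)
    (s : seq (set R)) :
  size (online_coloring A s) = size s.
Proof.
by elim/last_ind: s => // s I; rewrite online_coloring_rcons !size_rcons => ->.
Qed.

(** The rule picks any color that restores the invariant.  It
    looks at the history and the new interval only, hence is online; on
    histories that it never produces it may fall back on [j0]. *)
Lemma online_invariant {R : realType} {c : nat} (Inv : history R c -> Prop) :
    'I_c -> Inv [::] ->
    (forall h I, open_interval I -> Inv h -> exists j, Inv (rcons h (I, j))) ->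
  exists A : online_rule R c, forall s : seq (set R),
    (forall I, I \in s -> open_interval I) -> Inv (online_coloring A s).
Proof.
move=> j0 Inv0 InvS.
exists (fun h I => xget j0 [set j | Inv (rcons h (I, j))]%classic).
elim/last_ind => // s I IHs sP; rewrite online_coloring_rcons.
have /InvS/(_ _)/xgetPex : open_interval I.
  by apply: sP; rewrite mem_rcons mem_head.
apply; apply: IHs => J Js; apply: sP.
by rewrite mem_rcons inE Js orbT.
Qed.

Lemma colors_online_light (R : realType) (m N k : nat) :
    (0 < m)%N -> (0 < k)%N -> (N < 2 ^ (m * k.-1))%N ->
  exists A : online_rule R (4 * m), colors_online N k A.
Proof.
move=> m_gt0 k_gt0 ltN.
pose lev (i : 'I_(4 * m)) := (i %/ 4)%N.
have lev_lt i : (lev i < m)%N by rewrite /lev ltn_divLR // [(m * 4)%N]mulnC.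
have lev4 b : (b < m)%N -> (4 <= #|[pred i | lev i == b]|)%N.
  move=> lt_bm; have ltP (r : 'I_4) : (4 * b + r < 4 * m)%N.
    by have := ltn_ord r; lia.
  pose f r := Ordinal (ltP r).
  have f_inj : injective f by move=> r r' [] /addnI /val_inj.
  apply: (@leq_trans #|codom f|); first by rewrite card_codom // card_ord.
  apply/subset_leq_card.
  apply/fintype.subsetP => _ /codomP[r ->].
  by rewrite inE /lev /= mulnC divnMDl // divn_small ?addn0.
have j0 : 'I_(4 * m) by apply: (@Ordinal _ 0); lia.
have light0 : @light_subdivision R _ m lev [::].
  exists (fun=> 0%N), [:: (j0, 0%N)]; split=> //.
  by rewrite big_seq1.
have [A AP] := online_invariant _ j0 light0
  (fun h I => light_subdivision_rcons m lev h I m_gt0 lev_lt lev4).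
exists A => s sP i le_i.
apply: (light_subdivision_two_colored m k lev) => //.
  rewrite size_online_coloring; apply: leq_ltn_trans ltN.
  by rewrite size_take size_tuple; case: ltnP.
by apply: AP => I /mem_take /tnthP[r ->].
Qed.

Theorem corollary12 (R : realType) :
  exists a b : R, 0 < a /\ a <= b /\
    forall k : nat, (2 <= k)%N ->
      exists N0 : nat, forall N : nat, (N0 <= N)%N ->
        exists c : nat,
          a * (ln N%:R / k%:R) <= c%:R /\
          c%:R <= b * (ln N%:R / k%:R) /\
          exists A : online_rule R c, colors_online N k A.
Proof.
exists 1, 20; split=> //; split; first by lra.
move=> k k_ge2; exists (2 ^ (2 * k))%N => N leN.
have N_gt0 : (0 < N)%N by apply: leq_trans leN; rewrite expn_gt0.
have k1_gt0 : (0 < k.-1)%N by lia.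
pose t := trunc_log 2 N; pose m := (t %/ k.-1).+1.
have leN2 : (2 ^ t <= N)%N by exact: trunc_logP.
have t_ge : (2 * k <= t)%N by exact: trunc_log_max.
have ltN2 : (N < 2 ^ (m * k.-1))%N.
  apply: leq_trans (trunc_log_ltn N (isT : (1 < 2)%N)) _.
  by rewrite leq_exp2l // ltn_ceil.
have mk_le : (4 * m * k <= 10 * t)%N.
  by have := leq_trunc_div t k.-1; rewrite /m; nia.
have ln2_ge : 2^-1 <= ln 2 :> R.
  have : ln (1 + - 2^-1) <= - 2^-1 :> R by apply: le_ln1Dx; lra.
  have -> : 1 + - 2^-1 = 2^-1 :> R by lra.
  by rewrite lnV ?posrE // lerN2.
have ln2_le : ln 2 <= 1 :> R.
  by have := @le_ln1Dx R 1; apply; lra.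
(* Both bounds on [4 * m] follow by comparing [ln N] with multiples of [ln 2]:
   [N < 2 ^ (m * k.-1)] for the lower one, [2 ^ t <= N] for the upper one.  The
   size of [N] enters through [2 * k <= t], which absorbs the rounding of [m],
   and [k <= 2 * k.-1] turns [k.-1] into [k]. *)
have k_gt0 : 0 < k%:R :> R by rewrite ltr0n; lia.
have N_gt0R : 0 < N%:R :> R by rewrite ltr0n.
exists (4 * m)%N; split; last split.
- rewrite mul1r ler_pdivrMr // -natrM.
  have : ln N%:R <= ln (2 ^ (m * k.-1))%:R :> R.
    by rewrite ler_ln ?posrE ?ltr0n ?expn_gt0 // ler_nat ltnW.
  rewrite natrX lnXn // => /le_trans; apply.
  apply: (@le_trans _ _ (m * k.-1)%:R); last by rewrite ler_nat; nia.
  by rewrite -[leRHS]mulr1 -[leLHS]mulr_natl ler_wpM2l.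
- rewrite mulrA ler_pdivlMr // -natrM.
  have : ln (2 ^ t)%:R <= ln N%:R :> R.
    by rewrite ler_ln ?posrE ?ltr0n ?expn_gt0 // ler_nat.
  rewrite natrX lnXn // -[X in X <= _ -> _]mulr_natl => le_t.
  apply: (@le_trans _ _ (10 * t)%:R); first by rewrite ler_nat.
  have : t%:R * 2^-1 <= t%:R * ln 2 :> R by rewrite ler_wpM2l.
  by rewrite natrM; lra.
- by apply: colors_online_light; lia.
Qed.
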